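(* Let $\mathcal{B}=(V,E)$ be a graph with an adapted complex structure $J$ (on the associated Lie algebra $\mathfrak{n}_{\mathcal{B}}$). Then the following statements are equivalent: (i) all the edges in $\mathcal{B}$ are distinguished; (ii) $\mathcal{B}$ is the (disjoint) union of some copies of $\mathbb{A}_1$, $\mathbb{A}_2$ or $\mathbb{A}_3$, and each copy is equipped with (i.e. is $J$-invariant and $J$ restricts to it as) the adapted complex structure on $\mathbb{A}_1$, $\mathbb{A}_2$, $\mathbb{A}_3$, respectively, described in the context; (iii) the adapted complex structure $J$ on $\mathfrak{n}_{\mathcal{B}}$ is abelian.
   Context: Graphs are finite and simple: $\mathcal{G}=(V,E)$ with $V$ a finite set and $E$ a set of 2-element subsets of $V$; $\overline{uv}$ denotes the edge $\{u,v\}$. Label $V=\{v_1,\dots,v_n\}$ and write $e_{i,j}$ ($i<j$) for the edge joining $v_i$ and $v_j$, if it exists. The Lie algebra $\mathfrak{n}_{\mathcal{G}}$ is the real vector space with basis $V\cup E$ and Lie bracket $[v_i,v_j]=e_{i,j}$ for $i<j$ if $v_i,v_j$ are adjacent, $[v_i,v_j]=0$ if they are not adjacent, and all elements of $E$ central. A complex structure on a real Lie algebra $\mathfrak{g}$ is a linear map $J:\mathfrak{g}\to\mathfrak{g}$ with $J^2=-\mathrm{Id}$ and $N_J(x,y):=[x,y]+J([Jx,y]+[x,Jy])-[Jx,Jy]=0$ for all $x,y\in\mathfrak{g}$. It is abelian if $[Jx,Jy]=[x,y]$ for all $x,y\in\mathfrak{g}$. A complex structure $J$ on $\mathfrak{n}_{\mathcal{G}}$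 is adapted if for every $x\in V\cup E$ either $Jx\in V\cup E$ or $-Jx\in V\cup E$. An edge is distinguished (with respect to $J$) if it joins a pair of vertices $v,w$ with $w=Jv$. The graphs $\mathbb{A}_1,\mathbb{A}_2,\mathbb{A}_3$ and their adapted complex structures (images being understood up to sign): - $\mathbb{A}_1$: two vertices $v_1,v_2$ and no edges; $Jv_1=v_2$. - $\mathbb{A}_2$: three vertices $v_1,v_2,v_3$ and the single edge $e_{1,2}$; $Jv_1=v_2$, $Jv_3=e_{1,2}$. - $\mathbb{A}_3$: four vertices $v_1,v_2,v_3,v_4$ and the edges $e_{1,2}$, $e_{3,4}$; $Jv_1=v_2$, $Jv_3=v_4$, $Je_{1,2}=e_{3,4}$. In each case $J^2=-\mathrm{Id}$. *)

(* Defs.v *)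
From HB Require Import structures.
From mathcomp Require Import all_boot all_order all_algebra.
From mathcomp Require Import reals.

Set Implicit Arguments.
Unset Strict Implicit.
Unset Printing Implicit Defensive.

Import Order.TTheory GRing.Theory Num.Theory.
Local Open Scope ring_scope.

(* Finite simple graphs on a labelled vertex set. Labels start at 0: the vertex
   usually written v_i is the ordinal i - 1. *)
Record graph (n : nat) := Graph {
  edges :> {set {set 'I_n}};
  card_edge : forall e, e \in edges -> #|e| = 2%N
}.

(* The basis V u E of the Lie algebra of a graph. *)
Definition basis n (B : graph n) : finType :=
  ('I_n + {e : {set 'I_n} | e \in edges B})%type.

Notation nlie R B := {ffun basis B -> R^o}.

Section LieAlgebra.
Variables (R : realType) (n : nat) (B : graph n).
Implicit Types (a b : basis B) (i j : 'I_n).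

Definition bvec b : nlie R B := [ffun c => (c == b)%:R].

Definition vtx i : nlie R B := bvec (inl i).

(* The basis vector of the edge {v_i, v_j}; it is 0 when v_i and v_j are not
   adjacent (in particular when i = j). *)
Definition edge i j : nlie R B :=
  if insub [set i; j] is Some e then bvec (inr e) else 0.

Definition bracket_basis a b : nlie R B :=
  match a, b with
  | inl i, inl j => if (i < j)%N then edge i j else - edge i j
  | _, _ => 0
  end.

Definition bracket (x y : nlie R B) : nlie R B :=
  \sum_a \sum_b (x a * y b) *: bracket_basis a b.

Definition Nijenhuis (J : {linear nlie R B -> nlie R B}) (x y : nlie R B) :=
  bracket x y + J (bracket (J x) y + bracket x (J y)) - bracket (J x) (J y).

Definition complex_structure (J : {linear nlie R B -> nlie R B}) : Prop :=
  (forall x, J (J x) = - x) /\ (forall x y, Nijenhuis J x y = 0).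

Definition abelian_cs (J : {linear nlie R B -> nlie R B}) : Prop :=
  forall x y, bracket (J x) (J y) = bracket x y.

Definition adapted (J : {linear nlie R B -> nlie R B}) : Prop :=
  forall b, exists c, J (bvec b) = bvec c \/ - J (bvec b) = bvec c.

Definition distinguished (J : {linear nlie R B -> nlie R B}) (e : {set 'I_n}) :
    Prop :=
  exists v w : 'I_n, e = [set v; w] /\ vtx w = J (vtx v).

End LieAlgebra.

Arguments bvec R {n B} b.
Arguments vtx R {n} B i.
Arguments edge R {n} B i j.

Definition eq_sign (U : zmodType) (x y : U) : Prop := x = y \/ x = - y.

Local Notation "''v[' n ]_ k" := (@Ordinal n k isT)
  (at level 8, k at level 2, format "''v[' n ]_ k").

Definition A1_edges : {set {set 'I_2}} := set0.

Definition A2_edges : {set {set 'I_3}} := [set [set 'v[3]_0; 'v[3]_1]].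

Definition A3_edges : {set {set 'I_4}} :=
  [set [set 'v[4]_0; 'v[4]_1]; [set 'v[4]_2; 'v[4]_3]].

Fact A1_card e : e \in A1_edges -> #|e| = 2%N.
Proof. by rewrite inE. Qed.

Fact A2_card e : e \in A2_edges -> #|e| = 2%N.
Proof. by rewrite inE => /eqP->; rewrite cards2. Qed.

Fact A3_card e : e \in A3_edges -> #|e| = 2%N.
Proof. by rewrite !inE => /orP[] /eqP->; rewrite cards2. Qed.

Definition A1 : graph 2 := Graph A1_card.
Definition A2 : graph 3 := Graph A2_card.
Definition A3 : graph 4 := Graph A3_card.

Section Models.
Variable R : realType.

(* Only the up-to-sign image of one element of each pair {b, +-Jb} is prescribed:
   J^2 = -Id, which is part of complex_structure, gives the others. *)
Definition model1 (J : {linear nlie R A1 -> nlie R A1}) : Prop :=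
  complex_structure J /\ eq_sign (J (vtx R A1 'v[2]_0)) (vtx R A1 'v[2]_1).

Definition model2 (J : {linear nlie R A2 -> nlie R A2}) : Prop :=
  [/\ complex_structure J,
      eq_sign (J (vtx R A2 'v[3]_0)) (vtx R A2 'v[3]_1)
    & eq_sign (J (vtx R A2 'v[3]_2)) (edge R A2 'v[3]_0 'v[3]_1)].

Definition model3 (J : {linear nlie R A3 -> nlie R A3}) : Prop :=
  [/\ complex_structure J,
      eq_sign (J (vtx R A3 'v[4]_0)) (vtx R A3 'v[4]_1),
      eq_sign (J (vtx R A3 'v[4]_2)) (vtx R A3 'v[4]_3)
    & eq_sign (J (edge R A3 'v[4]_0 'v[4]_1)) (edge R A3 'v[4]_2 'v[4]_3)].

End Models.

Section Union.
Variables (R : realType) (n : nat) (B : graph n).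
Variable J : {linear nlie R B -> nlie R B}.

(* The subgraph of B induced on S is the image of A under the isomorphism f.
   The Lie algebra morphism phi induced by f (it is determined by its values on
   the vertices) intertwines a model structure JA with J; in particular its
   image is J-invariant. *)
Definition is_copy k (A : graph k)
    (model : {linear nlie R A -> nlie R A} -> Prop) (S : {set 'I_n}) : Prop :=
  exists (f : 'I_k -> 'I_n) (JA : {linear nlie R A -> nlie R A})
         (phi : {linear nlie R A -> nlie R B}),
    [/\ injective f, f @: setT = S
      & [set e in edges B | e \subset S]
          = [set f @: (e : {set 'I_k}) | e in edges A]] /\
    [/\ forall i, phi (vtx R A i) = vtx R B (f i),
        forall x y, phi (bracket x y) = bracket (phi x) (phi y),
        model JA
      & forall x, J (phi x) = phi (JA x)].

Definition union_of_models : Prop :=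
  exists P : {set {set 'I_n}},
    [/\ partition P setT,
        forall e, e \in edges B -> exists2 S, S \in P & e \subset S
      & forall S, S \in P ->
          [\/ is_copy (@model1 R) S, is_copy (@model2 R) S
            | is_copy (@model3 R) S]].

End Union.

(* Main.v *)
Require Import Defs.
From HB Require Import structures.
From mathcomp Require Import all_boot all_order all_algebra.
From mathcomp Require Import reals.

(** Since [J] permutes the basis [V u E] up to sign, it is described by a
    fixed-point-free involution [sgm] of [V u E]. The edge [vw] is distinguished
    iff [sgm v = w], so if every edge is distinguished then the edges are
    pairwise disjoint, and the component of an edge [e] consists of [e] together
    with [sgm e], which is either an isolated vertex ([A_2]) or another edge
    ([A_3]); the vertices left over are paired by [sgm] into copies of [A_1].
    On the abelian side, [[v, w] = [Jv, Jw] <> 0] forces [{Jv, Jw} = {v, w}]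
    up to sign. *)

Set Implicit Arguments.
Unset Strict Implicit.
Unset Printing Implicit Defensive.

Import Order.TTheory GRing.Theory Num.Theory.
Local Open Scope ring_scope.

(** * Basis vectors, bilinearity and antisymmetry of the bracket *)

Section BasisVectors.
Variables (R : realType) (n : nat) (B : graph n).
Implicit Types (a b c : basis B) (x y : nlie R B) (i j : 'I_n).

Lemma bvecE b c : bvec R b c = (c == b)%:R.
Proof. by rewrite ffunE. Qed.

Lemma bvec_neq0 b : bvec R b != 0.
Proof.
by apply/eqP => /ffunP/(_ b); rewrite !ffunE eqxx => /eqP; rewrite oner_eq0.
Qed.

Lemma bvec_sum x : x = \sum_b x b *: bvec R b.
Proof.
apply/ffunP => c; rewrite sum_ffunE (bigD1 c) //= big1 ?addr0 => [|b bc].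
  by rewrite !ffunE eqxx /GRing.scale /= mulr1.
by rewrite !ffunE eq_sym (negPf bc) scaler0.
Qed.

(** The coordinate at [b] of the left side is a sign, hence nonzero, which forces [c = b] on the
    right; the signs are then compared. *)
Lemma signed_bvec_inj (s t : bool) b c :
  (-1) ^+ s *: bvec R b = (-1) ^+ t *: bvec R c -> b = c /\ s = t.
Proof.
move=> /ffunP/(_ b); rewrite !ffunE eqxx /GRing.scale /= mulr1.
case: eqVneq => [-> | _] /=; rewrite ?mulr1 => /eqP;
  last by rewrite mulr0 signr_eq0.
by rewrite (inj_eq (@signr_inj _)) => /eqP ->.
Qed.

Lemma bracket_suml (I : finType) (F : I -> nlie R B) (p : I -> R) y :
  bracket (\sum_i p i *: F i) y = \sum_i p i *: bracket (F i) y.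
Proof.
rewrite /bracket.
under [RHS]eq_bigr do rewrite scaler_sumr.
rewrite [RHS]exchange_big /=; apply: eq_bigr => a _.
under [RHS]eq_bigr do rewrite scaler_sumr.
rewrite [RHS]exchange_big /=; apply: eq_bigr => b _.
under [RHS]eq_bigr do rewrite scalerA mulrA.
rewrite -scaler_suml -mulr_suml; congr (_ * _ *: _).
by rewrite sum_ffunE; apply: eq_bigr => i _; rewrite !ffunE.
Qed.

Lemma bracket_sumr (I : finType) (F : I -> nlie R B) (p : I -> R) x :
  bracket x (\sum_i p i *: F i) = \sum_i p i *: bracket x (F i).
Proof.
rewrite /bracket.
under [RHS]eq_bigr do rewrite scaler_sumr.
rewrite [RHS]exchange_big /=; apply: eq_bigr => a _.
under [RHS]eq_bigr do rewrite scaler_sumr.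
rewrite [RHS]exchange_big /=; apply: eq_bigr => b _.
under [RHS]eq_bigr do rewrite scalerA mulrCA.
rewrite -scaler_suml -mulr_sumr; congr (_ * _ *: _).
by rewrite sum_ffunE; apply: eq_bigr => i _; rewrite !ffunE.
Qed.

Lemma bracketZl (p : R) x y : bracket (p *: x) y = p *: bracket x y.
Proof. by have := bracket_suml (fun _ : 'I_1 => x) (fun=> p) y; rewrite !big_ord1. Qed.

Lemma bracketZr (p : R) x y : bracket x (p *: y) = p *: bracket x y.
Proof. by have := bracket_sumr (fun _ : 'I_1 => y) (fun=> p) x; rewrite !big_ord1. Qed.

Lemma bracket_bvec a b : bracket (bvec R a) (bvec R b) = bracket_basis R a b.
Proof.
rewrite /bracket (bigD1 a) //= [X in _ + X]big1 ?addr0 => [|a' aa'].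
  rewrite (bigD1 b) //= big1 ?addr0 => [|b' bb'].
    by rewrite !bvecE !eqxx mulr1 scale1r.
  by rewrite !bvecE (negPf bb') mulr0 scale0r.
by rewrite big1 // => b' _; rewrite !bvecE (negPf aa') mul0r scale0r.
Qed.

Lemma linear_bvec (V : lmodType R) (F : {linear nlie R B -> V}) x :
  F x = \sum_b x b *: F (bvec R b).
Proof.
by rewrite {1}[x]bvec_sum linear_sum; under eq_bigr do rewrite linearZ.
Qed.

Lemma edgeC i j : edge R B i j = edge R B j i.
Proof. by rewrite /edge setUC. Qed.

Lemma edge_bvec i j (e : {e : {set 'I_n} | e \in edges B}) :
  val e = [set i; j] -> edge R B i j = bvec R (inr e).
Proof. by move=> eij; rewrite /edge -eij valK. Qed.

Lemma edge_eq0 i j : (edge R B i j == 0) = ([set i; j] \notin edges B).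
Proof.
by rewrite /edge; case: insubP => [e -> _|/negPf ->];
  rewrite ?eqxx ?(negPf (bvec_neq0 _)).
Qed.

Lemma bracketN a b :
  bracket (bvec R b) (bvec R a) = - bracket (bvec R a) (bvec R b).
Proof.
rewrite !bracket_bvec; case: a b => [i|e] [j|e'] /=; rewrite ?oppr0 //.
rewrite edgeC; case: ltngtP => [||/val_inj ->]; rewrite ?opprK //.
(* On the diagonal the bracket is [- edge i i], which vanishes because a singleton is not an
   edge. *)
suff /eqP -> : edge R B i i == 0 by rewrite oppr0.
by rewrite edge_eq0; apply/negP => /card_edge; rewrite setUid cards1.
Qed.

Lemma bracket_basis_edge i j (eB : [set i; j] \in edges B) :
  bracket_basis R (inl i) (inl j) =
    (-1) ^+ (~~ (i < j)%N) *:
      bvec R (inr (exist (fun e => e \in edges B) [set i; j] eB)).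
Proof.
rewrite /= (@edge_bvec i j (exist (fun e => e \in edges B) [set i; j] eB)) //.
by case: ifP; rewrite ?scale1r ?scaleN1r.
Qed.

Lemma bracket_basis_neq0 a b : bracket_basis R a b != 0 ->
  exists i j, [/\ a = inl i, b = inl j & [set i; j] \in edges B].
Proof.
case: a b => [i|e] [j|e'] /=; rewrite ?eqxx //; case: ifP => _;
  by rewrite ?oppr_eq0 edge_eq0 negbK => ij; exists i, j.
Qed.

End BasisVectors.

(** By bilinearity it suffices to look at basis vectors. Two maps are allowed so as to cover both
    Lie algebra morphisms ([F = G]) and abelian structures ([F = J], [G] the identity). *)
Lemma bracket_morphP (R : realType) (m n : nat) (A : graph m) (B : graph n)
    (F G : {linear nlie R A -> nlie R B}) :
  (forall a b, bracket (F (bvec R a)) (F (bvec R b)) =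
     G (bracket (bvec R a) (bvec R b))) ->
  forall x y, bracket (F x) (F y) = G (bracket x y).
Proof.
move=> FG x y; rewrite (linear_bvec F x) (linear_bvec F y).
rewrite {2}[x]bvec_sum {2}[y]bvec_sum.
rewrite !bracket_suml linear_sum; apply: eq_bigr => a _.
rewrite linearZ; congr (_ *: _).
by rewrite !bracket_sumr linear_sum; apply: eq_bigr => b _; rewrite linearZ FG.
Qed.


(** * Lie algebra maps induced by embeddings onto induced subgraphs *)

Section Copy.
Variables (R : realType) (k n : nat) (A : graph k) (B : graph n).

Section BasisMap.
Variable g : basis A -> basis B.

Definition push (x : nlie R A) : nlie R B := \sum_a x a *: bvec R (g a).

(** The transpose of [push]; for injective [g] it is a left inverse of [push], and it later serves
    to restrict [J]. *)
Definition pull (y : nlie R B) : nlie R A := [ffun a => y (g a)].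

Fact push_is_linear : linear push.
Proof.
move=> p x y; rewrite /push scaler_sumr -big_split; apply: eq_bigr => a _ /=.
by rewrite !ffunE scalerA scalerDl.
Qed.

Fact pull_is_linear : linear pull.
Proof. by move=> p x y; apply/ffunP => a; rewrite !ffunE. Qed.

HB.instance Definition _ :=
  GRing.isLinear.Build R (nlie R A) (nlie R B) *:%R push push_is_linear.
HB.instance Definition _ :=
  GRing.isLinear.Build R (nlie R B) (nlie R A) *:%R pull pull_is_linear.

Lemma push_bvec a : push (bvec R a) = bvec R (g a).
Proof.
rewrite /push (bigD1 a) //= big1 ?addr0 => [|b ba].
  by rewrite bvecE eqxx scale1r.
by rewrite bvecE (negPf ba) scale0r.
Qed.

Lemma pushK : injective g -> cancel push pull.
Proof.
move=> g_inj x; apply/ffunP => a; rewrite ffunE {2}[x]bvec_sum !sum_ffunE.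
by apply: eq_bigr => b _; rewrite !ffunE (inj_eq g_inj).
Qed.

End BasisMap.

Variable f : 'I_k -> 'I_n.
Hypothesis f_inj : injective f.
Hypothesis fE : [set e in edges B | e \subset f @: setT] =
  [set f @: (e : {set 'I_k}) | e in edges A].

Let imset_edge (e : {set 'I_k}) : e \in edges A -> f @: e \in edges B.
Proof.
move=> eA; have := imset_f (fun e : {set 'I_k} => f @: e) eA.
by rewrite -fE inE => /andP[].
Qed.

Definition basis_map (a : basis A) : basis B :=
  match a with
  | inl i => inl (f i)
  | inr e =>
      inr (exist (fun e => e \in edges B) (f @: val e) (imset_edge (valP e)))
  end.

Lemma basis_map_inj : injective basis_map.
Proof.
move=> [i|e] [j|e'] //= [] => [/f_inj -> // | /(imset_inj f_inj)/val_inj -> //].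
Qed.

(** A basis element comes from the subgraph induced on a vertex set exactly when its support lies in
    that set. *)
Definition supp m (C : graph m) (b : basis C) : {set 'I_m} :=
  match b with inl i => [set i] | inr e => val e end.

Lemma basis_map_supp a : supp (basis_map a) \subset f @: setT.
Proof. by case: a => [i|e] /=; rewrite ?sub1set ?imset_f ?imsetS ?subsetT. Qed.

Lemma basis_map_onto b : supp b \subset f @: setT -> exists a, b = basis_map a.
Proof.
case: b => [j|e] /=; first by rewrite sub1set => /imsetP[i _ ->];
  exists (inl i).
move=> eS.
have : val e \in [set e in edges B | e \subset f @: setT].
  by rewrite inE (valP e).
rewrite fE => /imsetP[e' e'A eE].
exists (inr (exist (fun e => e \in edges A) e' e'A)).
by congr inr; apply: val_inj.
Qed.

Lemma imset_pair_edge i j :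
  ([set f i; f j] \in edges B) = ([set i; j] \in edges A).
Proof.
have fij : f @: [set i; j] = [set f i; f j] by rewrite imsetU1 imset_set1.
rewrite -fij; apply/idP/idP => [ijB|]; last exact: imset_edge.
have : f @: [set i; j] \in [set e in edges B | e \subset f @: setT].
  by rewrite inE ijB imsetS ?subsetT.
by rewrite fE => /imsetP[e eA /(imset_inj f_inj) ->].
Qed.

Lemma push_edge i j : push basis_map (edge R A i j) = edge R B (f i) (f j).
Proof.
have [ijA|ijA] := boolP ([set i; j] \in edges A).
  rewrite (@edge_bvec _ _ _ i j (exist (fun e => e \in edges A) _ ijA)) //.
  rewrite push_bvec.
  by apply/esym/edge_bvec; rewrite /= imsetU1 imset_set1.
have /eqP -> : edge R A i j == 0 by rewrite edge_eq0.
by rewrite linear0; apply/esym/eqP; rewrite edge_eq0 imset_pair_edge.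
Qed.

Hypothesis f_mono : forall i j,
  [set i; j] \in edges A -> (i < j)%N -> (f i < f j)%N.

(** The order of the labels decides the sign of a bracket, and [f_mono] keeps this order along
    edges. For non-adjacent vertices both sides vanish, the subgraph being induced. *)
Lemma push_bracket x y :
  push basis_map (bracket x y) = bracket (push basis_map x) (push basis_map y).
Proof.
pose phi : {linear nlie R A -> nlie R B} := push basis_map.
apply/esym; move: x y; apply: (@bracket_morphP _ _ _ _ _ phi phi) => a b /=.
rewrite /phi /= !push_bvec !bracket_bvec.
case: a b => [i|e] [j|e'] /=; rewrite ?linear0 //.
have [ijA|ijA] := boolP ([set i; j] \in edges A); last first.
  have /eqP h : edge R A i j == 0 by rewrite edge_eq0.
  rewrite -push_edge h linear0 oppr0 if_same.
  by case: ifP => _; rewrite ?oppr0 linear0.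
have ij : i != j by have := card_edge ijA; rewrite cards2; case: eqP.
rewrite -push_edge.
case: (ltngtP i j) ij => [ij _|ji _|/ord_inj ->]; last by rewrite eqxx.
  by rewrite (f_mono ijA ij).
by rewrite ltnNge ltnW ?linearN // f_mono // setUC.
Qed.

End Copy.

Lemma imset_tnth (T : finType) k (t : k.-tuple T) :
  tnth t @: setT = [set x in t].
Proof.
apply/setP => x; rewrite inE.
apply/imsetP/tnthP => [[i _ ->]|[i ->]]; first by exists i.
by exists i.
Qed.

Lemma ltn_pair_inj k (i j a b : 'I_k) :
  [set i; j] = [set a; b] -> (i < j)%N -> (a < b)%N -> i = a /\ j = b.
Proof.
move=> E ij ab.
have : i \in [set a; b] by rewrite -E !inE eqxx.
have : j \in [set a; b] by rewrite -E !inE eqxx orbT.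
rewrite !inE => /orP[] /eqP ? /orP[] /eqP ?; subst i j => //.
- by rewrite ltnn in ij.
- by rewrite ltnNge ltnW in ij.
- by rewrite ltnn in ij.
Qed.

(** This lets the prescriptions of a model be checked in the ambient algebra, where [J] is known. *)
Lemma eq_sign_inj (U V : zmodType) (phi : {additive U -> V}) x y :
  injective phi -> eq_sign (phi x) (phi y) -> eq_sign x y.
Proof. by move=> phi_inj; rewrite /eq_sign -raddfN => -[] /phi_inj; auto. Qed.

(** * Adapted complex structures as signed permutations of the basis *)

Section SignedPermutation.
Variables (R : realType) (n : nat) (B : graph n).
Variable J : {linear nlie R B -> nlie R B}.
Hypothesis cJ : complex_structure J.
Variables (sgm : basis B -> basis B) (s : basis B -> bool).
Hypothesis JE : forall b, J (bvec R b) = (-1) ^+ s b *: bvec R (sgm b).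

Let JJ x : J (J x) = - x.
Proof. by case: cJ => + _; apply. Qed.

(** Expanding [J (J b) = - b] gives both facts; the opposite signs are what excludes fixed points of
    [sgm]. *)
Let sgm_sign b : sgm (sgm b) = b /\ s (sgm b) = ~~ s b.
Proof.
have := JJ (bvec R b).
rewrite JE linearZ /= JE scalerA -signr_addb -scaleN1r -[-1]expr1 => h.
by case: (signed_bvec_inj (t := true) h) => ->; case: (s b); case: (s (sgm b)).
Qed.

Lemma sgmK : involutive sgm.
Proof. by move=> b; case: (sgm_sign b). Qed.

Lemma sign_sgm b : s (sgm b) = ~~ s b.
Proof. by case: (sgm_sign b). Qed.

Lemma sgm_neq b : sgm b != b.
Proof. by apply/eqP => h; have := sign_sgm b; rewrite h; case: (s b). Qed.

Lemma eq_sign_sgm b c : sgm b = c -> eq_sign (J (bvec R b)) (bvec R c).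
Proof.
move=> <-; rewrite JE; case: (s b); first by right; rewrite expr1 scaleN1r.
by left; rewrite expr0 scale1r.
Qed.

Lemma eq_sign_sgmP b c : eq_sign (J (bvec R b)) (bvec R c) -> sgm b = c.
Proof.
rewrite JE => -[|]; [rewrite -[RHS]scale1r -[1](expr0 (-1)) |
  rewrite -scaleN1r -[-1]expr1].
  by move=> /(signed_bvec_inj (t := false))[].
by move=> /(signed_bvec_inj (t := true))[].
Qed.

Lemma distinguishedP i j : [set i; j] \in edges B ->
  distinguished J [set i; j] <-> sgm (inl i) = inl j.
Proof.
move=> eB; split.
  have ij : i != j by have := card_edge eB; rewrite cards2; case: eqP.
  move=> [v [w [evw Jv]]].
  have sv : sgm (inl v) = inl w.
    by apply: eq_sign_sgmP; left; rewrite -/(vtx R B v) -Jv.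
  have sw : sgm (inl w) = inl v by rewrite -sv sgmK.
  have : i \in [set v; w] by rewrite -evw !inE eqxx.
  have : j \in [set v; w] by rewrite -evw !inE eqxx orbT.
  by rewrite !inE => /orP[] /eqP jE /orP[] /eqP iE; subst i j => //;
    rewrite eqxx in ij.
move=> sij; have := JE (inl i); rewrite sij; case: (s _); last first.
  by rewrite expr0 scale1r => Ji; exists i, j.
(* If [J] sends [i] to minus [j], it sends [j] to plus [i]; so swapping the endpoints yields the
   positive sign that [distinguished] demands. *)
rewrite expr1 scaleN1r => Ji; exists j, i; split; first by rewrite setUC.
by rewrite /vtx -[bvec R (inl j)]opprK -Ji linearN JJ opprK.
Qed.

(** * Abelian structures and distinguished edges *)

Lemma abelian_distinguished :
  abelian_cs J -> forall e, e \in edges B -> distinguished J e.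
Proof.
move=> abJ e eB; have /eqP/cards2P[i [j [ij eE]]] := card_edge eB; subst e.
apply/(distinguishedP eB).
have := abJ (bvec R (inl i)) (bvec R (inl j)).
rewrite !JE bracketZl bracketZr scalerA -signr_addb !bracket_bvec.
rewrite (bracket_basis_edge R eB) => /[dup] h.
have : bracket_basis R (sgm (inl i)) (sgm (inl j)) != 0.
  apply: contra_eq_neq h => ->.
  by rewrite scaler0 eq_sym scaler_eq0 signr_eq0 bvec_neq0.
move=> /bracket_basis_neq0[k [l [sk sl kl]]].
rewrite sk sl (bracket_basis_edge R kl).
rewrite scalerA -signr_addb => /signed_bvec_inj[[klE] _].
(* The partner [k] of [i] is an endpoint of the same edge and differs from [i], so it is [j]. *)
have : k \in [set i; j] by rewrite -klE !inE eqxx.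
rewrite !inE => /orP[] /eqP kE; subst k; last by [].
by have := sgm_neq (inl i); rewrite sk eqxx.
Qed.

(** Only pairs [b], [sgm b] can have a nonzero bracket. For these, [J] swaps the two vectors with
    opposite signs, and the resulting minus sign cancels against antisymmetry. *)
Lemma distinguished_abelian :
  (forall e, e \in edges B -> distinguished J e) -> abelian_cs J.
Proof.
move=> dist x y; apply: (@bracket_morphP _ _ _ _ _ J idfun) => {x y} a b /=.
have key c d : bracket_basis R c d != 0 -> sgm c = d.
  move=> /bracket_basis_neq0[i [j [-> -> ij]]].
  by apply/(distinguishedP ij)/dist.
rewrite !JE bracketZl bracketZr scalerA -signr_addb !bracket_bvec.
have [sab|sab] := eqVneq (sgm a) b.
  rewrite -sab sgmK sign_sgm addbN addbb expr1 scaleN1r.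
  by rewrite -!bracket_bvec bracketN opprK.
have /eqP -> : bracket_basis R a b == 0 by apply: contraNT sab => /key/eqP.
suff /eqP -> : bracket_basis R (sgm a) (sgm b) == 0 by rewrite scaler0.
by apply: contraNT sab => /key; rewrite sgmK => ->; rewrite sgmK.
Qed.


(* The Lie algebra map induced by [f] sends [e_{i,j}] to [e_{f i, f j}] without a
   sign because [f] is increasing along edges; [JA] is the restriction of [J]. *)
Lemma is_copy_of_embedding k (A : graph k) (f : 'I_k -> 'I_n)
    (model : {linear nlie R A -> nlie R A} -> Prop) :
  injective f ->
  [set e in edges B | e \subset f @: setT] =
    [set f @: (e : {set 'I_k}) | e in edges A] ->
  (forall i j, [set i; j] \in edges A -> (i < j)%N -> (f i < f j)%N) ->
  (forall b, supp b \subset f @: setT -> supp (sgm b) \subset f @: setT) ->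
  (forall (JA : {linear nlie R A -> nlie R A})
          (phi : {linear nlie R A -> nlie R B}),
     complex_structure JA -> injective phi ->
     (forall x, J (phi x) = phi (JA x)) ->
     (forall i, phi (vtx R A i) = vtx R B (f i)) ->
     (forall i j, phi (edge R A i j) = edge R B (f i) (f j)) -> model JA) ->
  is_copy J model (f @: setT).
Proof.
have [_ NJ] := cJ; move=> f_inj fE f_mono sgm_stable modelP.
set g := basis_map fE; have g_inj : injective g by exact: basis_map_inj.
pose phi : {linear nlie R A -> nlie R B} := push g.
pose psi : {linear nlie R B -> nlie R A} := pull g.
have phiK : cancel phi psi by exact: pushK.
have phi_bvec a : phi (bvec R a) = bvec R (g a) by exact: push_bvec.
have phiB x y : phi (bracket x y) = bracket (phi x) (phi y).
  exact: push_bracket.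
pose JA : {linear nlie R A -> nlie R A} := psi \o J \o phi.
have phiJ x : J (phi x) = phi (JA x).
  have -> : J (phi x) = \sum_a x a *: J (phi (bvec R a)).
    exact: linear_bvec (J \o phi) x.
  have -> : phi (JA x) = \sum_a x a *: phi (JA (bvec R a)).
    exact: linear_bvec (phi \o JA) x.
  apply: eq_bigr => a _; congr (_ *: _); rewrite /JA /=.
  rewrite phi_bvec JE linearZ /= linearZ /=; congr (_ *: _).
  (* Stability keeps the image under [J] inside the range of [phi], where the left inverse [psi] is
     a true inverse. *)
  have [c ->] := basis_map_onto fE (sgm_stable _ (basis_map_supp fE a)).
  by rewrite -/g -phi_bvec phiK.
have vE i : phi (vtx R A i) = vtx R B (f i) by exact: push_bvec.
have csJA : complex_structure JA.
  split=> [x|x y]; apply: (can_inj phiK); first by rewrite -!phiJ JJ linearN.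
  rewrite linear0 /Nijenhuis linearB linearD -phiJ linearD !phiB -!phiJ.
  exact: NJ.
exists f, JA, phi; split; split => //.
apply: (modelP JA phi) => //; [exact: can_inj phiK | exact: push_edge].
Qed.

(** * Distinguished edges form a matching *)

Section DistinguishedEdges.
Hypothesis dist : forall e, e \in edges B -> distinguished J e.

Local Notation edge_type := {e : {set 'I_n} | e \in edges B}.

Lemma edge_sgm (e : edge_type) i : i \in val e ->
  exists2 j, sgm (inl i) = inl j & val e = [set i; j].
Proof.
have /eqP/cards2P[v [w [_ eE]]] := card_edge (valP e).
have vwB : [set v; w] \in edges B by rewrite -eE (valP e).
have svw : sgm (inl v) = inl w by apply/(distinguishedP vwB)/dist.
rewrite eE !inE => /orP[] /eqP ->; first by exists w.
by exists v; rewrite 1?setUC // -svw sgmK.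
Qed.

(** An endpoint determines its edge, since the other endpoint must be its partner under [sgm]. *)
Lemma edge_unique (e e' : edge_type) i : i \in val e -> i \in val e' -> e = e'.
Proof.
move=> /edge_sgm[j sj eE] /edge_sgm[k sk e'E]; apply: val_inj.
by move: sj; rewrite eE e'E sk => -[->].
Qed.

(** The endpoints come in increasing order, as the monotonicity condition on embeddings requires. *)
Lemma edge_ltn (e : edge_type) :
  exists i j : 'I_n, [/\ (i < j)%N, sgm (inl i) = inl j & val e = [set i; j]].
Proof.
have /eqP/cards2P[v [w [vw eE]]] := card_edge (valP e).
have [|j sj eE'] := @edge_sgm e v; first by rewrite eE !inE eqxx.
case: (ltngtP v j) => [vj|jv|/ord_inj vj].
- by exists v, j.
- by exists j, v; rewrite setUC -sj sgmK.
- by have := sgm_neq (inl v); rewrite sj vj eqxx.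
Qed.

(** * Decomposition of the vertex set into [J]-stable blocks *)

Definition pair_supp (b : basis B) := supp b :|: supp (sgm b).

(* When [pair_supp (inl i)] is an edge, that edge joins [v_i] to [J v_i] and the
   block must also contain the support of its own partner. *)
Definition block i :=
  if insub (pair_supp (inl i)) is Some e then pair_supp (inr e)
  else pair_supp (inl i).

Lemma sub_block i : pair_supp (inl i) \subset block i.
Proof. by rewrite /block; case: insubP => [e _ <-|_] //; exact: subsetUl. Qed.

Lemma mem_block i : i \in block i.
Proof. by apply: (subsetP (sub_block i)); rewrite !inE eqxx. Qed.

(** The vertex [i] is an endpoint of [e], an endpoint of the edge [sgm e], or the vertex [sgm e]
    itself. *)
Lemma block_edge (e : edge_type) i :
  i \in pair_supp (inr e) -> block i = pair_supp (inr e).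
Proof.
have in_edge (e' : edge_type) k : k \in val e' -> block k = pair_supp (inr e').
  by move=> /edge_sgm[j sj eE]; rewrite /block {1}/pair_supp sj /= -eE valK.
rewrite inE => /orP[/in_edge //|].
case se: (sgm (inr e)) => [k|e'] /=; last first.
  by move=> /in_edge ->; rewrite /pair_supp -se sgmK setUC se.
have sk : sgm (inl k) = inr e by rewrite -se sgmK.
rewrite inE => /eqP ->; rewrite /block; case: insubP => [u _ uE|_].
  (* A vertex on an edge is paired with a vertex, whereas [k] is paired with the edge [e]. *)
  have : k \in val u by rewrite uE !inE eqxx.
  by move=> /edge_sgm[j]; rewrite sk.
by rewrite /pair_supp se sk setUC.
Qed.

Lemma blockP i : (exists e, block i = pair_supp (inr e)) \/
  (exists j, [/\ sgm (inl i) = inl j, [set i; j] \notin edges B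
                & block i = [set i; j]]).
Proof.
case si: (sgm (inl i)) => [j|e].
  rewrite /block /pair_supp si /=.
  by case: insubP => [e _ _|ijB]; [left; exists e | right; exists j].
left; exists e; apply: block_edge.
by rewrite /pair_supp -si sgmK !inE eqxx orbT.
Qed.

(** Blocks are thus classes of an equivalence relation, which makes them pairwise disjoint or
    equal. *)
Lemma block_eq i j : j \in block i -> block j = block i.
Proof.
case: (blockP i) => [[e ->]|[k [si ikB ->]]]; first exact: block_edge.
rewrite !inE => /orP[] /eqP ->.
  by rewrite /block /pair_supp si /= insubN.
have sk : sgm (inl k) = inl i by rewrite -si sgmK.
by rewrite /block /pair_supp sk /= setUC insubN.
Qed.

Lemma block_of_edge (e : edge_type) i :
  i \in val e -> block i = pair_supp (inr e).
Proof. by move=> ie; apply: block_edge; rewrite inE ie. Qed.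

Lemma edge_vertex (e : edge_type) : exists i, i \in val e.
Proof. by have [i [j [_ _ ->]]] := edge_ltn e; exists i; rewrite !inE eqxx. Qed.

Lemma block_stable i b : supp b \subset block i -> supp (sgm b) \subset block i.
Proof.
case: b => [j|e] /=.
  rewrite sub1set => /block_eq <-; apply: subset_trans (sub_block j).
  exact: subsetUr.
have [j je] := edge_vertex e => /subsetP/(_ j je)/block_eq <-.
by rewrite (block_of_edge je); exact: subsetUr.
Qed.

(** This finds the edges induced on a block. An endpoint of [e'] lies on [e] or on [sgm e]; if
    [sgm e] is a vertex, it lies on no edge, its partner not being a vertex. *)
Lemma edge_sub_pair (e e' : edge_type) :
  val e' \subset pair_supp (inr e) -> e' = e \/ sgm (inr e) = inr e'.
Proof.
have [i ie'] := edge_vertex e' => /subsetP/(_ i ie'); rewrite inE => /orP[ie|].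
  by left; rewrite (edge_unique ie ie').
case se: (sgm (inr e)) => [k|e''] /=; last first.
  by move=> ie''; right; rewrite (edge_unique ie'' ie').
rewrite inE => /eqP ik; subst k.
by have [j] := edge_sgm ie'; rewrite -se sgmK.
Qed.

(** * Identification of the blocks with the three models *)

Lemma block_copy i : [\/ is_copy J (@model1 R) (block i),
  is_copy J (@model2 R) (block i) | is_copy J (@model3 R) (block i)].
Proof.
case: (blockP i) (@block_stable i) => [[e ->]|[j [si ijB ->]]] stable.
  have [a [b [ab sa eE]]] := edge_ltn e.
  have neq_ab : a != b by rewrite neq_ltn ab.
  case se: (sgm (inr e)) => [k|e'].
    have kN : k \notin val e.
      by apply/negP => /edge_sgm[j]; rewrite -se sgmK.
    constructor 2.
    (* The tuple follows the labels of [A2]: the edge first, in increasing order, then the vertex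
       paired with it. *)
    pose t := [tuple a; b; k].
    have tS : pair_supp (inr e) = tnth t @: setT.
      by apply/setP => x; rewrite imset_tnth /pair_supp se /= eE !inE orbA.
    rewrite tS in stable *; apply: is_copy_of_embedding => //.
    - apply/tuple_uniqP; rewrite /= !inE negb_or neq_ab andbT.
      rewrite !(eq_sym _ k) -negb_or.
      by move: kN; rewrite eE !inE.
    - rewrite -tS imset_set1 imsetU1 imset_set1 /= -eE.
      apply/setP => e1; rewrite !inE; apply/andP/eqP => [[e1B e1S]|->].
        by case: (@edge_sub_pair e (exist _ e1 e1B) e1S) => [<-|]; rewrite ?se.
      by rewrite (valP e) subsetUl.
    - by move=> x y; rewrite inE => /eqP /ltn_pair_inj h /h[] // -> ->.
    - move=> JA phi csJA phi_inj phiJ phiV phiE.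
      split=> //; apply: (eq_sign_inj phi_inj); rewrite /= -phiJ ?phiE !phiV.
        exact: eq_sign_sgm sa.
      rewrite (_ : edge R B _ _ = bvec R (inr e)); last exact (edge_bvec R eE).
      by apply: eq_sign_sgm; rewrite -se sgmK.
  constructor 3.
  have [c [d [cd sc e'E]]] := edge_ltn e'.
  have neq_cd : c != d by rewrite neq_ltn cd.
  (* A common vertex would give [e = e'], a fixed point of [sgm]. *)
  have disj k : k \in val e -> k \notin val e'.
    move=> ke; apply/negP => /(edge_unique ke) ee'.
    by have := sgm_neq (inr e); rewrite se ee' eqxx.
  pose t := [tuple a; b; c; d].
  have tS : pair_supp (inr e) = tnth t @: setT.
    by apply/setP => x; rewrite imset_tnth /pair_supp se /= eE e'E !inE -orbA.
  rewrite tS in stable *; apply: is_copy_of_embedding => //.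
  - apply/tuple_uniqP; rewrite /= !inE negb_or neq_ab neq_cd andbT /=.
    have := disj a; have := disj b; rewrite eE e'E !inE !eqxx orbT.
    by move=> /(_ isT) -> /(_ isT) ->.
  - rewrite -tS imsetU1 imset_set1 !imsetU1 !imset_set1 /= -eE -e'E.
    apply/setP => e1; rewrite !inE; apply/andP/orP => [[e1B e1S]|[] /eqP ->].
    + case: (@edge_sub_pair e (exist _ e1 e1B) e1S) => [<-|]; first by left.
      by rewrite se => -[->]; right.
    + by rewrite (valP e) subsetUl.
    + by rewrite (valP e') /pair_supp se subsetUr.
  - by move=> x y; rewrite !inE => /orP[] /eqP /ltn_pair_inj h /h[] // -> ->.
  - move=> JA phi csJA phi_inj phiJ phiV phiE.
    split=> //; apply: (eq_sign_inj phi_inj); rewrite /= -phiJ ?phiE ?phiV.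
    + exact: eq_sign_sgm sa.
    + exact: eq_sign_sgm sc.
    + rewrite (_ : edge R B _ _ = bvec R (inr e)); last exact (edge_bvec R eE).
      rewrite (_ : edge R B _ _ = bvec R (inr e')); last exact (edge_bvec R e'E).
      exact: eq_sign_sgm.
constructor 1.
have neq_ij : i != j.
  by apply/eqP => ij; have := sgm_neq (inl i); rewrite si ij eqxx.
pose t := [tuple i; j].
have tS : [set i; j] = tnth t @: setT.
  by apply/setP => x; rewrite imset_tnth !inE.
rewrite tS in stable *; apply: is_copy_of_embedding => //.
- by apply/tuple_uniqP; rewrite /= !inE neq_ij.
- rewrite -tS imset0; apply/setP => e1; rewrite !inE.
  apply/negP => /andP[e1B e1S].
  (* An edge inside the block joins one of [i], [j] to its partner, so it would be the excluded
     pair. *)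
  pose e : edge_type := exist _ e1 e1B.
  have [x xe] := edge_vertex e; have [y sx eE] := edge_sgm xe.
  have := subsetP e1S x xe; rewrite !inE => /orP[] /eqP xE; subst x.
    by move: sx ijB; rewrite si => -[->]; rewrite -eE (valP e).
  by move: sx ijB; rewrite -si sgmK => -[->]; rewrite setUC -eE (valP e).
- by move=> x y; rewrite inE.
- move=> JA phi csJA phi_inj phiJ phiV phiE.
  split=> //; apply: (eq_sign_inj phi_inj); rewrite /= -phiJ !phiV.
  exact: eq_sign_sgm si.
Qed.

Lemma distinguished_union : union_of_models J.
Proof.
exists (block @: setT); split.
- apply/and3P; split.
  + apply/eqP/setP => i; rewrite inE; apply/bigcupP.
    by exists (block i); [exact: imset_f | exact: mem_block].
  + apply/trivIsetP => _ _ /imsetP[i _ ->] /imsetP[j _ ->]; apply: contraR.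
    by move=> /pred0Pn[k /andP[/= /block_eq <- /block_eq <-]].
  + by apply/imsetP => -[i _ b0]; have := mem_block i; rewrite -b0 inE.
- move=> e eB; pose e' : edge_type := exist _ e eB.
  have [i ie] := edge_vertex e'; exists (block i); first exact: imset_f.
  by rewrite (block_of_edge ie) subsetUl.
- by move=> _ /imsetP[i _ ->]; exact: block_copy.
Qed.

End DistinguishedEdges.

(** * From unions of models back to distinguished edges *)

(** Each edge inside [S] is the image of a model edge, whose endpoints are exchanged up to sign by
    [JA]; the intertwining map [phi] carries this relation over to [J]. *)
Lemma copy_distinguished k (A : graph k) model S e :
  (forall JA : {linear nlie R A -> nlie R A}, model JA ->
   forall e, e \in edges A ->
    exists i j, e = [set i; j] /\ eq_sign (JA (vtx R A i)) (vtx R A j)) ->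
  is_copy J model S -> e \in edges B -> e \subset S -> distinguished J e.
Proof.
move=> modelP [f [JA [phi [[_ _ fE] [phiV _ /modelP{}modelP phiJ]]]]] eB eS.
have : e \in [set e in edges B | e \subset S] by rewrite inE eB.
rewrite fE => /imsetP[_ /modelP[i [j [-> JAi]]] eE].
have {}eE : e = [set f i; f j] by rewrite eE imsetU1 imset_set1.
subst e; apply/(distinguishedP eB)/eq_sign_sgmP.
change (eq_sign (J (vtx R B (f i))) (vtx R B (f j))); rewrite -!phiV phiJ.
by case: JAi => ->; [left | right; rewrite linearN].
Qed.

Lemma union_distinguished : union_of_models J ->
  forall e, e \in edges B -> distinguished J e.
Proof.
move=> [P [_ eP copyP]] e eB; have [S /copyP SP eS] := eP e eB.
case: SP => /copy_distinguished; apply=> // JA.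
- by move=> _ e'; rewrite inE.
- by move=> [_ J0 _] e' /set1P ->; do 2!eexists; split; [reflexivity|].
- by move=> [_ J0 J2 _] e' /set2P[] ->; do 2!eexists; split; first reflexivity.
Qed.

End SignedPermutation.

(** * The cycle of implications *)

Theorem proposition5p1 (R : realType) (n : nat) (B : graph n)
    (J : {linear nlie R B -> nlie R B})
    (hJ : complex_structure J) (aJ : adapted J) :
  [<-> (forall e, e \in edges B -> distinguished J e);
       union_of_models J;
       abelian_cs J].
Proof.
(* Finite choice turns adaptedness into functions: [p] gives the partner and the sign of each basis
   element. *)
have /fin_all_exists[p Jp] b :
    exists p : basis B * bool, J (bvec R b) = (-1) ^+ p.2 *: bvec R p.1.
  have [c [Jb|Jb]] := aJ b; first by exists (c, false); rewrite scale1r.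
  by exists (c, true); rewrite -Jb expr1 scaleN1r opprK.
have JE b : J (bvec R b) = (-1) ^+ (snd \o p) b *: bvec R ((fst \o p) b).
  exact: Jp.
tfae=> [dist | U | abJ].
- exact (distinguished_union hJ JE dist).
(* The way from a union of models to an abelian structure passes through distinguished edges. *)
- exact (distinguished_abelian hJ JE (union_distinguished hJ JE U)).
- exact (abelian_distinguished hJ JE abJ).
Qed.
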